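(* Let $J=\{1,\ldots,M\}\times\{1,\ldots,N\}$, let $\mathscr{S}$ be a grid triangulation of $[1,M]\times[1,N]$, and let $G^c_{\mathscr{S}}=(J,\bar E)$ be its conflict graph. Let $\{(\tilde A^{1,j},\tilde B^{1,j})\}_{j=1}^{t_1}$ and $\{(\tilde A^{2,j},\tilde B^{2,j})\}_{j=1}^{t_2}$ be biclique covers of the conflict graphs of SOS2$(M)$ and SOS2$(N)$, respectively. For each $u\in\{0,1,2\}^2$ define $$A^{3,u}=J\cap(u+3\mathbb{Z}^2),\qquad B^{3,u}=\bigcup_{w\in J\cap(u+3\mathbb{Z}^2)}\{w+v:v\in\{-1,1\}^2,\ \{w,w+v\}\in\bar E\}.$$ Then $\{(A^{1,j},B^{1,j})\}_{j=1}^{t_1}\cup\{(A^{2,j},B^{2,j})\}_{j=1}^{t_2}\cup\{(A^{3,u},B^{3,u})\}_{u\in\{0,1,2\}^2}$ is a biclique cover of $G^c_{\mathscr{S}}$, where $$A^{1,j}=\tilde A^{1,j}\times\{1,\ldots,N\},\quad B^{1,j}=\tilde B^{1,j}\times\{1,\ldots,N\}\quad(1\le j\le t_1),$$ $$A^{2,j'}=\{1,\ldots,M\}\times\tilde A^{2,j'},\quad B^{2,j'}=\{1,\ldots,M\}\times\tilde B^{2,j'}\quad(1\le j'\le t_2).$$ In particular, if $\{h^{1,i}\}_{i=1}^{M-1}\subseteq\{0,1\}^{\lceil\log_2(M-1)\rceil}$ and $\{h^{2,i}\}_{i=1}^{N-1}\subseteq\{0,1\}^{\lceil\log_2(N-1)\rceil}$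 are Gray codes, where $h^{1,0}:=h^{1,1}$, $h^{1,M}:=h^{1,M-1}$, $h^{2,0}:=h^{2,1}$, $h^{2,N}:=h^{2,N-1}$, then a biclique cover of $G^c_{\mathscr{S}}$ of depth $\lceil\log_2(M-1)\rceil+\lceil\log_2(N-1)\rceil+9$ is given by $$A^{1,j}=\{(x,y)\in J:h^{1,x-1}_j=h^{1,x}_j=1\},\quad B^{1,j}=\{(x,y)\in J:h^{1,x-1}_j=h^{1,x}_j=0\},$$ $$A^{2,j'}=\{(x,y)\in J:h^{2,y-1}_{j'}=h^{2,y}_{j'}=1\},\quad B^{2,j'}=\{(x,y)\in J:h^{2,y-1}_{j'}=h^{2,y}_{j'}=0\},$$ $$A^{3,u}=J\cap(u+3\mathbb{Z}^2),\qquad B^{3,u}=\bigcup_{w\in J\cap(u+3\mathbb{Z}^2)}\{w+v:v\in\{-1,1\}^2,\ \{w,w+v\}\in\bar E\}$$ for all $j\in\{1,\ldots,\lceil\log_2(M-1)\rceil\}$, $j'\in\{1,\ldots,\lceil\log_2(N-1)\rceil\}$, and $u\in\{0,1,2\}^2$.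
   Context: A grid triangulation of $\Omega=[1,M]\times[1,N]$ is a family $\mathscr{S}$ of subsets of $J=\{1,\ldots,M\}\times\{1,\ldots,N\}$ such that: $|S|=3$ for each $S\in\mathscr{S}$; $\bigcup_{S\in\mathscr{S}}\operatorname{Conv}(S)=\Omega$ and $\operatorname{relint}(\operatorname{Conv}(S))\cap\operatorname{relint}(\operatorname{Conv}(T))=\emptyset$ for distinct $S,T\in\mathscr{S}$; and $\|v-w\|_\infty\le 1$ for all $S\in\mathscr{S}$ and $v,w\in S$. For a family $\mathscr{S}$ of subsets of a finite set $J$, a set $T\subseteq J$ is infeasible if it is contained in no $S\in\mathscr{S}$. The conflict graph is $(J,\bar E)$ with $\bar E$ the set of infeasible two-element subsets of $J$. SOS2$(N)$ is the family $\{\{\tau,\tau+1\}:1\le\tau\le N-1\}$ on ground set $\{1,\ldots,N\}$. A biclique cover of a graph $G=(J,E)$ is a collection of complete bipartite subgraphs of $G$, given by pairs $\{(A^j,B^j)\}_{j=1}^t$, that cover all edges of $G$; formally, for each $j$, $\emptyset\subsetneq A^j,B^j\subsetneq J$, $A^j\cap B^j=\emptyset$, and $\bigcup_{j=1}^t A^j*B^j=E$, where $A*B=\{\{a,b\}:a\in A,\ b\in B\}$. Its depth is the number $t$ of pairs. A Gray code is a sequence of distinct binary vectors in which each pair of consecutive vectors differs in exactly one component; $h_j$ denotes the $j$-th component of $h$.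
   Formalization: Some A^{3,u} or B^{3,u} can be empty (e.g. M=N=2), so the full family of the stated depth is shown to meet every condition except nonempty sides, and to be a biclique cover in the strict sense once the pairs (A^{3,u},B^{3,u}) with an empty side are dropped. *)

(* Defs.v *)
From mathcomp Require Import all_boot all_order all_algebra.
From mathcomp Require Import classical_sets reals topology normedtype convex.
From mathcomp Require Import finset.

Set Implicit Arguments.
Unset Strict Implicit.
Unset Printing Implicit Defensive.

Import Order.TTheory GRing.Theory Num.Theory.
Import numFieldNormedType.Exports.

Local Open Scope ring_scope.

Section RelativeInterior.
Context {R : realType} {V : normedModType R}.
Implicit Types A C : set V.

Definition convex_hull A : set V := smallest (@convex_set R V) A.

Definition affine_set A : Prop :=
  forall x y (t : R), A x -> A y -> A ((1 - t) *: x + t *: y).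

Definition affine_hull A : set V := smallest affine_set A.

Definition relint C : set V :=
  [set x | C x /\
    exists2 e : R, 0 < e & (ball x e `&` affine_hull C `<=` C)%classic]%classic.

End RelativeInterior.

Section Infeasibility.
Context {J : finType}.
Implicit Types SS : {set {set J}}.

Definition infeasible SS (T : {set J}) : bool :=
  ~~ [exists S in SS, T \subset S].

(* The edge set of the conflict graph, as a set of two-element subsets. *)
Definition conflict_edges SS : {set {set J}} :=
  [set e : {set J} | (#|e| == 2%N) && infeasible SS e].

End Infeasibility.

(* The ordinal i : 'I_N stands for the element i + 1 of {1, ..., N}; the shift
   is immaterial here. *)
Definition SOS2 (N : nat) : {set {set 'I_N}} :=
  [set [set t.1; t.2] | t : 'I_N * 'I_N & (t.2 == t.1.+1 :> nat)].

Section Bicliques.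
Context {J : finType}.
Implicit Types (p : {set J} * {set J}) (c : seq ({set J} * {set J})).
Implicit Types E : {set {set J}}.

(* A * B = {{a, b} : a in A, b in B} *)
Definition biclique_edges p : {set {set J}} :=
  [set [set a; b] | a in p.1, b in p.2].

Definition nontrivial p : bool := (p.1 != set0) && (p.2 != set0).

(* A collection of pairs is a sequence, so that its depth is its size.  In the
   relaxed notion a pair may have an empty side; it then covers no edge. *)
Definition relaxed_biclique_cover E c : Prop :=
  (forall p, p \in c ->
     [/\ p.1 \proper setT, p.2 \proper setT & p.1 :&: p.2 = set0])
  /\ \bigcup_(p <- c) biclique_edges p = E.

Definition biclique_cover E c : Prop :=
  relaxed_biclique_cover E c /\ (forall p, p \in c -> nontrivial p).

End Bicliques.

(* The norm of the library on R * R is the maximum norm. *)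
Definition plane (R : realType) : normedModType R := (R * R)%type.

(* The pair (i, j) stands for the point (i + 1, j + 1) of
   {1, ..., M} x {1, ..., N}. *)
Definition grid (M N : nat) : finType := ('I_M * 'I_N)%type.

Section Grid.
Context {M N : nat}.
Implicit Types (w z : grid M N) (SS : {set {set grid M N}}).

Definition xcoord w : nat := w.1.+1.
Definition ycoord w : nat := w.2.+1.

Definition grid_pt (R : realType) w : plane R := ((xcoord w)%:R, (ycoord w)%:R).

Definition conv_pts (R : realType) (S : {set grid M N}) : set (plane R) :=
  convex_hull [set grid_pt R w | w in [set` S]]%classic.
Arguments conv_pts R S : clear implicits.

Definition Omega (R : realType) : set (plane R) :=
  [set z | 1 <= z.1 <= M%:R /\ 1 <= z.2 <= N%:R]%classic.
Arguments Omega R : clear implicits.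

Definition grid_triangulation (R : realType) SS : Prop :=
  [/\ forall S, S \in SS -> #|S| = 3%N,
      (\bigcup_(S in [set` SS]) conv_pts R S = Omega R)%classic,
      forall S T, S \in SS -> T \in SS -> S != T ->
        (relint (conv_pts R S) `&` relint (conv_pts R T) = classical_sets.set0)%classic
    & forall S v w, S \in SS -> v \in S -> w \in S ->
        `|grid_pt R v - grid_pt R w| <= 1].

Definition lift_x (p : {set 'I_M} * {set 'I_M}) :
    {set grid M N} * {set grid M N} :=
  (setX p.1 [set: 'I_N], setX p.2 [set: 'I_N]).

Definition lift_y (p : {set 'I_N} * {set 'I_N}) :
    {set grid M N} * {set grid M N} :=
  (setX [set: 'I_M] p.1, setX [set: 'I_M] p.2).

Definition residue_class (u : 'I_3 * 'I_3) : {set grid M N} :=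
  [set w | (xcoord w == u.1 %[mod 3])%N && (ycoord w == u.2 %[mod 3])%N].

(* z - w lies in {-1, 1}^2 *)
Definition diagonal w z : bool :=
  ((xcoord z)%:Z - (xcoord w)%:Z \in [:: -1; 1]) &&
  ((ycoord z)%:Z - (ycoord w)%:Z \in [:: -1; 1]).

Definition diagonal_biclique SS (u : 'I_3 * 'I_3) :
    {set grid M N} * {set grid M N} :=
  (residue_class u,
   \bigcup_(w in residue_class u)
     [set z | diagonal w z && ([set w; z] \in conflict_edges SS)]).

Definition diagonal_bicliques SS : seq ({set grid M N} * {set grid M N}) :=
  [seq diagonal_biclique SS u | u : 'I_3 * 'I_3].

(* For coord = xcoord or ycoord and a coordinate value x, the pair compares the
   j-th components of the code words h (x - 1) and h x. *)
Definition gray_biclique (k : nat) (coord : grid M N -> nat)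
    (h : nat -> k.-tuple bool) (j : 'I_k) : {set grid M N} * {set grid M N} :=
  ([set w | tnth (h (coord w).-1) j && tnth (h (coord w)) j],
   [set w | ~~ tnth (h (coord w).-1) j && ~~ tnth (h (coord w)) j]).

Definition gray_bicliques (k : nat) (coord : grid M N -> nat)
    (h : nat -> k.-tuple bool) : seq ({set grid M N} * {set grid M N}) :=
  [seq gray_biclique coord h j | j : 'I_k].

End Grid.

(* h 1, ..., h n is a Gray code; the other values of h are not constrained. *)
Definition gray_code (n k : nat) (h : nat -> k.-tuple bool) : Prop :=
  (forall i i', (1 <= i <= n)%N -> (1 <= i' <= n)%N -> h i = h i' -> i = i')
  /\ (forall i, (1 <= i < n)%N ->
        #|[set j | tnth (h i) j != tnth (h i.+1) j]| = 1%N).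

(* Main.v *)
(* A conflict edge {v, w} is of one of two kinds.  If some coordinate differs by
   at least 2, that coordinate gives a conflict edge of SOS2, so a lifted
   biclique covers {v, w}.  Otherwise v and w lie in a common unit cell, and they
   must be opposite corners of it: the midpoint of a unit axis-parallel segment
   lies in some triangle of the cover, and since triangles have max-norm diameter
   at most 1, a separating line shows that both endpoints are vertices of that
   triangle, so the pair is feasible.  Diagonal pairs are covered by the residue
   class of v; another point of this class is at distance at least 3 from v, hence
   at distance at least 2 from every diagonal neighbour of v, so these bicliques
   contain conflict edges only.
   In the Gray code covers of SOS2, one-bit steps and distinctness of the code
   words yield, for indices x and y at least 2 apart, a bit that is constant on
   h (x - 1), h x, constant on h (y - 1), h y, and different on the two pairs.
   No side is empty: if a bit never took the value b on two consecutive words,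
   then flipping it to b and back would repeat a word, so it would never be b, and
   the M - 1 words would fit into one bit less than they need. *)
From mathcomp Require Import classical_sets prodnormedzmodule interval_inference.
From mathcomp Require Import normedtype convex zify lra.
Require Import Defs.
From mathcomp Require Import all_boot all_order all_algebra.
From mathcomp Require Import reals.

Import Order.TTheory GRing.Theory Num.Theory.

(** * Geometry of grid triangulations: axis-parallel unit segments are feasible *)

Lemma grid_coord_inj {M N : nat} (v w : grid M N) :
  xcoord v = xcoord w -> ycoord v = ycoord w -> v = w.
Proof.
by case: v w => [v1 v2] [w1 w2]; rewrite /xcoord /ycoord /= =>
  -[/val_inj ->] [/val_inj ->].
Qed.

Section LatticeEdge.
Local Open Scope ring_scope.

(* The first hypothesis says that (x + 1/2, y) lies in the convex hull of the
   points (p w, q w). *)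
Lemma lattice_edge_in (R : realType) (T : finType) (S : {set T})
    (p q : T -> nat) (x y : nat) :
  (forall a b c : R,
     (forall w, w \in S -> c <= a * (p w)%:R + b * (q w)%:R) ->
     c <= a * (x%:R + 2^-1) + b * y%:R) ->
  (forall v w, v \in S -> w \in S ->
     (p v <= (p w).+1)%N /\ (q v <= (q w).+1)%N) ->
  forall d : bool, exists2 w, w \in S & p w = (x + d)%N /\ q w = y.
Proof.
move=> sep diam d.
(* If no such [u] existed, the half-plane with first coordinate at least [x + 1] would contain all
   of [S] but not the midpoint; [v] is symmetric. With diameter 1 this leaves only the columns [x]
   and [x + 1]. *)
have [u uS pu] : exists2 u, u \in S & (p u <= x)%N.
  apply/exists_inP; apply: contraT; rewrite negb_exists_in => /forall_inP hp.
  have /= := sep 1 0 (x.+1)%:R; rewrite -natr1.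
  suff H w : w \in S -> x%:R + 1 <= 1 * (p w)%:R + 0 * (q w)%:R :> R.
    by move=> /(_ H); lra.
  by move=> /hp; rewrite -ltnNge -(ler_nat R) -natr1; lra.
have [v vS pv] : exists2 v, v \in S & (x < p v)%N.
  apply/exists_inP; apply: contraT; rewrite negb_exists_in => /forall_inP hp.
  have /= := sep (-1) 0 (- x%:R).
  suff H w : w \in S -> - x%:R <= -1 * (p w)%:R + 0 * (q w)%:R :> R.
    by move=> /(_ H); lra.
  by move=> /hp; rewrite -leqNgt -(ler_nat R); lra.
have px w : w \in S -> p w = x \/ p w = x.+1.
  by move=> wS; have := diam _ _ wS uS; have := diam _ _ vS wS; lia.
(* The values of [q] on [S] differ by at most 1, so the points off the row [y] all lie on the same
   side of it; the sign [s] records which side. *)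
have [s hs] : exists s : R, forall w, w \in S ->
    q w = y \/ 1 <= s * ((q w)%:R - y%:R).
  have [/exists_inP[z zS qz]|] := boolP [exists w in S, (q w < y)%N].
    exists (-1) => w wS; have [|ne] := eqVneq (q w) y; [by left|right].
    have : ((q w).+1 <= y)%N by have := diam _ _ wS zS; lia.
    by rewrite -(ler_nat R) -natr1; lra.
  rewrite negb_exists_in => /forall_inP hq.
  exists 1 => w wS; have [|ne] := eqVneq (q w) y; [by left|right].
  have : (y.+1 <= q w)%N by have := hq _ wS; lia.
  by rewrite -(ler_nat R) -natr1; lra.
suff /exists_inP[w wS /andP[/eqP pw /eqP qw]] :
  [exists w in S, (p w == x + d)%N && (q w == y)] by exists w.
apply: contraT; rewrite negb_exists_in => /forall_inP miss.
(* The separating line passes through the other endpoint [(x + 1 - d, y)] and through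
   [(x + d, y + s)]. If [S] misses [(x + d, y)], all of [S] lies on it or beyond it, while the
   midpoint lies strictly before it. *)
pose e : R := if d then -1 else 1.
have := sep e s (e * x%:R + s * y%:R + (if d then 0 else 1)).
suff H w : w \in S ->
    e * x%:R + s * y%:R + (if d then 0 else 1) <= e * (p w)%:R + s * (q w)%:R.
  by move=> /(_ H); rewrite /e; case: (d); lra.
move=> wS; have := miss w wS; rewrite negb_and.
by case: (hs w wS) (px w wS) => [->|hq] [->|->]; rewrite /e -?natr1;
  case: (d); rewrite ?addn0 ?addn1 ?eqxx ?orbF //=; lra.
Qed.

End LatticeEdge.

Section Geometry.
Local Open Scope ring_scope.
Context {R : realType} {M N : nat}.
Implicit Types (S : {set grid M N}) (v w z : grid M N).

(** A closed half-plane is convex, so it contains the smallest convex set around the points. Convex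
    hulls enter the proof only through this fact. *)
Lemma halfplane_conv_pts S (a b c : R) :
  (forall w, w \in S -> c <= a * (xcoord w)%:R + b * (ycoord w)%:R) ->
  forall p, conv_pts S p -> c <= a * p.1 + b * p.2.
Proof.
move=> HS; apply: (smallest_sub (X := fun p : plane R => c <= a * p.1 + b * p.2)).
- move=> x y t /set_mem/= hx /set_mem/= hy; apply/mem_set => /=.
  have t0 : 0 <= t%:num by [].
  have t1 : t%:num <= 1 by [].
  rewrite /conv /=.
  move: (t%:num) t0 t1 => s s0 s1; rewrite /unstable.onem.
  move: x y hx hy => [x1 x2] [y1 y2] /= hx hy.
  rewrite /GRing.scale /=.
  nra.
- by move=> _ [w wS <-]; exact: HS.
Qed.

Lemma grid_pt_norm_le1 v w :
  `|grid_pt R v - grid_pt R w| <= 1 ->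
  [/\ (xcoord v <= (xcoord w).+1)%N, (xcoord w <= (xcoord v).+1)%N,
      (ycoord v <= (ycoord w).+1)%N & (ycoord w <= (ycoord v).+1)%N].
Proof.
have aux (m n : nat) : `|m%:R - n%:R : R| <= 1 -> (m <= n.+1)%N /\ (n <= m.+1)%N.
  rewrite ler_norml -!(ler_nat R) -!natr1; lra.
rewrite prod_normE /= ge_max => /andP[/aux[? ?] /aux[? ?]]; by split.
Qed.

Lemma axis_edge_feasible (SS : {set {set grid M N}}) v w :
  grid_triangulation R SS ->
  (xcoord w = (xcoord v).+1 /\ ycoord w = ycoord v \/
   xcoord w = xcoord v /\ ycoord w = (ycoord v).+1) ->
  ~~ infeasible SS [set v; w].
Proof.
move=> [_ cover _ diam] adj; rewrite negbK.
pose p : plane R := (2^-1 * ((xcoord v)%:R + (xcoord w)%:R),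
                     2^-1 * ((ycoord v)%:R + (ycoord w)%:R)).
have bound n (i j : 'I_n) :
    1 <= 2^-1 * (i.+1%:R + j.+1%:R : R) <= n%:R.
  have := ltn_ord i; have := ltn_ord j.
  rewrite -!(ler_nat R) -(natr1 i) -(natr1 j).
  have := ler0n R i; have := ler0n R j => ? ? ? ?; apply/andP; split; lra.
have : @Omega M N R p by split; exact: bound.
rewrite -cover => -[S /= SSS Sp].
have sep a b c H := halfplane_conv_pts S a b c H p Sp.
apply/exists_inP; exists S => //.
rewrite subUset !sub1set.
have near z z' : z \in S -> z' \in S ->
    (xcoord z <= (xcoord z').+1)%N /\ (ycoord z <= (ycoord z').+1)%N.
  by move=> zS z'S; have [] := grid_pt_norm_le1 _ _ (diam _ _ _ SSS zS z'S).
case: adj => -[ex ey].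
- have edge := @lattice_edge_in R _ S xcoord ycoord (xcoord v) (ycoord v).
  have {}edge : forall d : bool,
      exists2 u, u \in S & xcoord u = (xcoord v + d)%N /\ ycoord u = ycoord v.
    apply: edge => // a b c /sep /=; rewrite ex ey -(natr1 (_ v)); lra.
  have [u uS [ux uy]] := edge false; have [u' u'S [ux' uy']] := edge true.
  have <- : u = v by apply: grid_coord_inj; rewrite ?ux ?uy ?addn0.
  have <- : u' = w by apply: grid_coord_inj; rewrite ?ux' ?uy' ?ex ?ey ?addn1.
  by rewrite uS u'S.
(* The vertical case exchanges the two coordinates, so the coefficients [a] and [b] of the
   half-plane are exchanged as well. *)
- have edge := @lattice_edge_in R _ S ycoord xcoord (ycoord v) (xcoord v).
  have {}edge : forall d : bool,
      exists2 u, u \in S & ycoord u = (ycoord v + d)%N /\ xcoord u = xcoord v.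
    apply: edge => [a b c H|z z' zS z'S].
      have H' z : z \in S -> c <= b * (xcoord z)%:R + a * (ycoord z)%:R.
        by move=> /H; lra.
      by have /= := sep _ _ _ H'; rewrite ex ey -(natr1 (_ v)); lra.
    by have [] := near _ _ zS z'S.
  have [u uS [ux uy]] := edge false; have [u' u'S [ux' uy']] := edge true.
  have <- : u = v by apply: grid_coord_inj; rewrite ?ux ?uy ?addn0.
  have <- : u' = w by apply: grid_coord_inj; rewrite ?ux' ?uy' ?ex ?ey ?addn1.
  by rewrite uS u'S.
Qed.

(** Some triangle covers the corner (1, 1). In a grid of width 1 the parity of the remaining
    coordinate would be injective on its three vertices, because they are at distance at most 1. *)
Lemma grid_triangulation_gt1 (SS : {set {set grid M N}}) :
  (0 < M)%N -> (0 < N)%N -> grid_triangulation R SS -> (1 < M)%N /\ (1 < N)%N.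
Proof.
move=> M0 N0 [card3 cover _ diam].
have : @Omega M N R (1, 1) by rewrite /Omega /= lexx !ler1n.
rewrite -cover => -[S /= SSS _].
have near z z' (zS : z \in S) (z'S : z' \in S) :=
  grid_pt_norm_le1 _ _ (diam _ _ _ SSS zS z'S).
have key (f : grid M N -> bool) : ~ {in S &, injective f}.
  move=> /card_in_imset; rewrite card3 // => fS.
  by have := max_card (mem (f @: S)); rewrite fS card_bool.
split; rewrite ltnNge; apply/negP => le1.
- apply: (key (fun z => odd (ycoord z))) => z z' zS z'S.
  have := near z z' zS z'S; rewrite /xcoord /ycoord => -[_ _ n1 n2] oz.
  by apply: grid_coord_inj; rewrite /xcoord /ycoord; [have := ltn_ord z.1; have := ltn_ord z'.1|]; lia.
- apply: (key (fun z => odd (xcoord z))) => z z' zS z'S.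
  have := near z z' zS z'S; rewrite /xcoord /ycoord => -[n1 n2 _ _] oz.
  by apply: grid_coord_inj; rewrite /xcoord /ycoord; [|have := ltn_ord z.2; have := ltn_ord z'.2]; lia.
Qed.
End Geometry.

(** * Edge sets of bicliques and of conflict graphs *)

Section ConflictEdges.
Context {J : finType}.
Implicit Types (E F : {set {set J}}) (p : {set J} * {set J}).

Lemma biclique_edgesP p e :
  reflect (exists a b, [/\ a \in p.1, b \in p.2 & e = [set a; b]])
          (e \in biclique_edges p).
Proof.
apply: (iffP imset2P) => [[a b pa pb ->]|[a [b [pa pb ->]]]].
  by exists a, b.
by exists a b.
Qed.

Lemma mem_conflict_edges E a b :
  ([set a; b] \in conflict_edges E) = (a != b) && infeasible E [set a; b].
Proof. by rewrite inE cards2; case: (a != b). Qed.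


Lemma conflict_edge_pair E e :
  e \in conflict_edges E -> exists a b, e = [set a; b].
Proof. by rewrite inE => /andP[/cards2P[a [b [_ ->]]] _]; exists a, b. Qed.

Lemma bigcup_biclique_edgesP E c :
  (forall p a b, p \in c -> a \in p.1 -> b \in p.2 ->
     [set a; b] \in conflict_edges E) ->
  (forall a b, [set a; b] \in conflict_edges E ->
     exists2 p, p \in c & [set a; b] \in biclique_edges p) ->
  \bigcup_(p <- c) biclique_edges p = conflict_edges E.
Proof.
move=> sub cov; rewrite bigcup_seq; apply/setP => e.
apply/bigcupP/idP => [[p pc /biclique_edgesP[a [b [pa pb ->]]]]|eE].
  exact: sub pc pa pb.
have [a [b def_e]] := conflict_edge_pair _ _ eE.
by rewrite def_e in eE *; have [p] := cov _ _ eE; exists p.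
Qed.

Lemma mem_bigcup_biclique_edges F c a b :
  \bigcup_(p <- c) biclique_edges p = F -> [set a; b] \in F ->
  exists2 p, p \in c &
    (a \in p.1) && (b \in p.2) || (b \in p.1) && (a \in p.2).
Proof.
move=> <-; rewrite bigcup_seq => /bigcupP[p pc].
case/biclique_edgesP => a' [b' [pa' pb' eab]]; exists p => //.
have : a' \in [set a; b] by rewrite eab set21.
have : b' \in [set a; b] by rewrite eab set22.
have : a \in [set a'; b'] by rewrite -eab set21.
have : b \in [set a'; b'] by rewrite -eab set22.
rewrite !inE.
case/orP => /eqP ->; case/orP => /eqP ->; rewrite ?pa' ?pb' ?orbT // !orbb.
  by move/eqP => <-; rewrite pb'.
by move=> _ /eqP <-; rewrite pa'.
Qed.

(** A pair with an empty side contributes no edge, so dropping it leaves the union unchanged. Such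
    pairs arise from residue classes without points or without diagonal conflicts. *)
Lemma relaxed_biclique_cover_nontrivial F c :
  relaxed_biclique_cover F c ->
  biclique_cover F [seq p <- c | nontrivial p].
Proof.
move=> [prop cov]; split; last by move=> p; rewrite mem_filter => /andP[].
split=> [p|]; first by rewrite mem_filter => /andP[_ /prop].
rewrite -cov big_filter [RHS](bigID (@nontrivial J)) /= [X in _ :|: X]big1 ?setU0 //.
move=> p; rewrite negb_and !negbK => triv.
apply/setP => e; rewrite inE; apply/negP => /biclique_edgesP[a [b [pa pb _]]].
by case/orP: triv => /eqP p0; rewrite p0 inE in pa pb.
Qed.
End ConflictEdges.

Lemma mem_conflict_edges_SOS2 (n : nat) (a b : 'I_n) :
  ([set a; b] \in conflict_edges (SOS2 n)) = (a.+1 < b) || (b.+1 < a).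
Proof.
rewrite mem_conflict_edges.
have [->|ne] := eqVneq a b; first by rewrite /=; lia.
have {}ne : a != b :> nat by [].
rewrite /= /infeasible; apply/idP/idP => [nS|far].
  suff : ~~ ((a.+1 == b) || (b.+1 == a)) by lia.
  apply: contra nS => adj; apply/exists_inP.
  exists [set a; b] => //; case/orP: adj => adj.
    by apply/imsetP; exists (a, b); rewrite ?inE /= 1?eq_sym.
  by apply/imsetP; exists (b, a); rewrite ?inE /= 1?eq_sym // setUC.
apply/exists_inP => -[S /imsetP[[s t]]]; rewrite inE /= => /eqP st {S}->.
rewrite subUset !sub1set !inE => /andP[].
by case/orP=> /eqP ?; case/orP=> /eqP ?; subst; lia.
Qed.

(** * Assembling the grid cover from lifted and diagonal bicliques *)

Section GridCover.
Context {M N : nat}.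
Implicit Types (v w z : grid M N) (SS : {set {set grid M N}}).

(** Max-norm distance at least 2, split so that each disjunct is one orientation of an SOS2 conflict
    in one coordinate. *)
Definition far v w : bool :=
  [|| (xcoord v).+1 < xcoord w, (xcoord w).+1 < xcoord v,
      (ycoord v).+1 < ycoord w | (ycoord w).+1 < ycoord v].

Lemma diagonalE w z : diagonal w z =
  ((xcoord z == (xcoord w).+1) || (xcoord w == (xcoord z).+1)) &&
  ((ycoord z == (ycoord w).+1) || (ycoord w == (ycoord z).+1)).
Proof.
by rewrite /diagonal !inE; move: (xcoord z) (ycoord z) (xcoord w) (ycoord w) =>
  a b c d; lia.
Qed.

Lemma far_or_diagonal_residue u w w' z :
  w \in residue_class u -> w' \in residue_class u ->
  diagonal w z -> far w' z || (w' == w).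
Proof.
rewrite !inE diagonalE /far => /andP[/eqP ux /eqP uy] /andP[/eqP ux' /eqP uy'] dz.
have [//|ne] := eqVneq w' w; first by rewrite orbT.
have : (xcoord w' != xcoord w) || (ycoord w' != ycoord w).
  apply: contraR ne; rewrite negb_or !negbK => /andP[/eqP ex /eqP ey].
  exact/eqP/grid_coord_inj.
move: dz ux uy ux' uy'.
move: (xcoord z) (ycoord z) (xcoord w) (ycoord w) (xcoord w') (ycoord w').
by move=> x y a b c d; lia.
Qed.

Lemma mem_diagonal_biclique SS u z :
  (z \in (diagonal_biclique SS u).2) =
  [exists w in residue_class u,
     diagonal w z && ([set w; z] \in conflict_edges SS)].
Proof.
apply/bigcupP/exists_inP => -[w wu wz]; exists w => //.
  by rewrite inE in wz.
by rewrite inE.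
Qed.

(** A diagonal step changes each coordinate by one, hence its residue modulo 3, and so leaves the
    class. *)
Lemma diagonal_biclique_disjoint SS u :
  (diagonal_biclique SS u).1 :&: (diagonal_biclique SS u).2 = set0.
Proof.
apply/setP => z; rewrite !inE; apply/negP => /andP[zu].
case/bigcupP => w; rewrite !inE diagonalE => wu /andP[dz _].
move: zu wu dz.
by move: (xcoord z) (ycoord z) (xcoord w) (ycoord w) => a b c d; lia.
Qed.

Lemma residue_class_proper u : 1 < M -> 0 < N ->
  residue_class u \proper [set: grid M N].
Proof.
move=> M1 N0; rewrite properT; apply/eqP => full.
pose w : grid M N := (Ordinal (ltnW M1), Ordinal N0).
pose w' : grid M N := (Ordinal M1, Ordinal N0).
have : w \in residue_class u by rewrite full inE.
have : w' \in residue_class u by rewrite full inE.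
rewrite !inE /xcoord /ycoord /=; lia.
Qed.

(** If the second side were the whole grid, disjointness would empty the residue class, and with it
    the union over that class. *)
Lemma diagonal_biclique_proper SS u : 1 < M -> 0 < N ->
  (diagonal_biclique SS u).2 \proper [set: grid M N].
Proof.
move=> M1 N0; rewrite properT; apply/eqP => full.
have := diagonal_biclique_disjoint SS u; rewrite full setIT => /= ru0.
have : (Ordinal (ltnW M1), Ordinal N0) \in (diagonal_biclique SS u).2.
  by rewrite full inE.
by case/bigcupP => w; rewrite ru0 inE.
Qed.

Lemma nontrivial_lift_x (p : {set 'I_M} * {set 'I_M}) :
  0 < N -> nontrivial p -> nontrivial (@lift_x M N p).
Proof.
move=> N0 /andP[/set0Pn[a pa] /set0Pn[b pb]].
by apply/andP; split; apply/set0Pn;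
  [exists (a, Ordinal N0)|exists (b, Ordinal N0)]; rewrite !inE /= ?pa ?pb.
Qed.

Lemma nontrivial_lift_y (p : {set 'I_N} * {set 'I_N}) :
  0 < M -> nontrivial p -> nontrivial (@lift_y M N p).
Proof.
move=> M0 /andP[/set0Pn[a pa] /set0Pn[b pb]].
by apply/andP; split; apply/set0Pn;
  [exists (Ordinal M0, a)|exists (Ordinal M0, b)]; rewrite !inE /= ?pa ?pb.
Qed.

Section Cover.
Context (SS : {set {set grid M N}}).
Hypothesis conflict_far : forall v w, far v w -> [set v; w] \in conflict_edges SS.
Hypothesis conflict_near :
  forall v w, [set v; w] \in conflict_edges SS -> far v w || diagonal v w.

Lemma relaxed_cover_grid
    (c1 : seq ({set 'I_M} * {set 'I_M})) (c2 : seq ({set 'I_N} * {set 'I_N})) :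
  1 < M -> 1 < N ->
  biclique_cover (conflict_edges (SOS2 M)) c1 ->
  biclique_cover (conflict_edges (SOS2 N)) c2 ->
  relaxed_biclique_cover (conflict_edges SS)
    (map lift_x c1 ++ map lift_y c2 ++ diagonal_bicliques SS).
Proof.
move=> M1 N1 [[prop1 cov1] _] [[prop2 cov2] _].
pose x0 : 'I_M := Ordinal (ltnW M1); pose y0 : 'I_N := Ordinal (ltnW N1).
have lx_proper (A : {set 'I_M}) : A \proper setT ->
    setX A [set: 'I_N] \proper [set: grid M N].
  case/properP => _ [x _ xA]; apply/properP; split; first exact: subsetT.
  by exists (x, y0); rewrite ?inE // (negPf xA).
have ly_proper (A : {set 'I_N}) : A \proper setT ->
    setX [set: 'I_M] A \proper [set: grid M N].
  case/properP => _ [y _ yA]; apply/properP; split; first exact: subsetT.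
  by exists (x0, y); rewrite ?inE // (negPf yA).
split.
  move=> p; rewrite !mem_cat => /or3P[/mapP[q qc ->]|/mapP[q qc ->]|].
  - have [q1 q2 q12] := prop1 q qc.
    split; [exact: lx_proper|exact: lx_proper|].
    apply/setP => z; rewrite !inE !andbT -in_setI q12 inE //.
  - have [q1 q2 q12] := prop2 q qc.
    split; [exact: ly_proper|exact: ly_proper|].
    by apply/setP => z; rewrite !inE /= -in_setI q12 inE.
  - case/imageP => u _ ->; split.
    + exact: residue_class_proper (ltnW N1).
    + exact: diagonal_biclique_proper (ltnW N1).
    + exact: diagonal_biclique_disjoint.
apply: bigcup_biclique_edgesP.
  move=> p a b; rewrite !mem_cat => /or3P[/mapP[q qc ->]|/mapP[q qc ->]|].
  - case: a b => [a1 a2] [b1 b2] /setXP[aq _] /setXP[bq _]; apply: conflict_far.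
    have : [set a1; b1] \in conflict_edges (SOS2 M).
      rewrite -cov1 bigcup_seq; apply/bigcupP; exists q => //.
      by apply/biclique_edgesP; exists a1, b1.
    by rewrite mem_conflict_edges_SOS2 /far /xcoord !ltnS => /orP[]->; rewrite ?orbT.
  - case: a b => [a1 a2] [b1 b2] /setXP[_ aq] /setXP[_ bq]; apply: conflict_far.
    have : [set a2; b2] \in conflict_edges (SOS2 N).
      rewrite -cov2 bigcup_seq; apply/bigcupP; exists q => //.
      by apply/biclique_edgesP; exists a2, b2.
    by rewrite mem_conflict_edges_SOS2 /far /ycoord !ltnS => /orP[]->; rewrite ?orbT.
  - case/imageP => u _ -> au; rewrite mem_diagonal_biclique.
    case/exists_inP => w wu /andP[dw wb].
    by case/orP: (far_or_diagonal_residue _ _ _ _ wu au dw) => [/conflict_far|/eqP ->].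
move=> a b ab; case/orP: (conflict_near _ _ ab) => [fab|dab]; last first.
  (* The residues of [a] select a class containing [a]; the diagonal conflict with [a] then puts [b]
     on the other side. *)
  pose u : 'I_3 * 'I_3 := (inord (xcoord a %% 3), inord (ycoord a %% 3)).
  have au : a \in residue_class u.
    by rewrite !inE /= !inordK ?ltn_pmod // !modn_mod !eqxx.
  exists (diagonal_biclique SS u).
    by rewrite !mem_cat (image_f (diagonal_biclique SS)) ?orbT.
  apply/biclique_edgesP; exists a, b; split => //.
  by rewrite mem_diagonal_biclique; apply/exists_inP; exists a; rewrite // dab.
have [x_far|y_far] : [set a.1; b.1] \in conflict_edges (SOS2 M) \/
    [set a.2; b.2] \in conflict_edges (SOS2 N).
  move: fab; rewrite !mem_conflict_edges_SOS2 /far /xcoord /ycoord !ltnS.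
  by case/or4P => ->; rewrite ?orbT; [left|left|right|right].
- have [q qc h] := mem_bigcup_biclique_edges _ _ _ _ cov1 x_far.
  exists (lift_x q); first by rewrite mem_cat map_f.
  apply/biclique_edgesP; case/orP: h => /andP[qa qb].
    by exists a, b; rewrite !inE qa qb.
  by exists b, a; rewrite !inE qa qb setUC.
- have [q qc h] := mem_bigcup_biclique_edges _ _ _ _ cov2 y_far.
  exists (lift_y q); first by rewrite !mem_cat map_f ?orbT.
  apply/biclique_edgesP; case/orP: h => /andP[qa qb].
    by exists a, b; rewrite !inE qa qb.
  by exists b, a; rewrite !inE qa qb setUC.
Qed.

End Cover.
End GridCover.

(** * Gray code covers of SOS2 *)

(** Without such a bit, wherever one of [a], [b] differs from one of [c], [d], either [a] and [b]
    differ or [c] and [d] differ. Each of these two pairs differs in at most one position, which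
    leaves too few positions to witness all four inequalities. *)
Lemma separating_bit {k : nat} (a b c d : k.-tuple bool) :
  #|[set j | tnth a j != tnth b j]| <= 1 ->
  #|[set j | tnth c j != tnth d j]| <= 1 ->
  a != c -> a != d -> b != c -> b != d ->
  exists j, [/\ tnth a j = tnth b j, tnth c j = tnth d j & tnth b j != tnth c j].
Proof.
move=> ab1 cd1 ac ad bc bd.
have diff (s t : k.-tuple bool) : s != t -> exists j, tnth s j != tnth t j.
  move=> st; apply/existsP; apply: contraR st => /existsPn st.
  by apply/eqP/eq_from_tnth => i; apply/eqP; have := st i; rewrite negbK.
have uniq1 (s t : k.-tuple bool) i j : #|[set j | tnth s j != tnth t j]| <= 1 ->
    tnth s i != tnth t i -> tnth s j != tnth t j -> i = j.
  by move=> /card_le1_eqP st si sj; apply: st; rewrite inE.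
have [/existsP[j /and3P[/eqP ? /eqP ? ?]]|/existsPn none] := boolP [exists j,
  [&& tnth a j == tnth b j, tnth c j == tnth d j & tnth b j != tnth c j]].
  by exists j.
have flip i : ~~ [&& tnth a i == tnth c i, tnth a i == tnth d i,
      tnth b i == tnth c i & tnth b i == tnth d i] ->
    tnth a i != tnth b i \/ tnth c i != tnth d i.
  move=> dist; apply/orP; have := none i; move: dist.
  by case: (tnth _ _); case: (tnth _ _); case: (tnth _ _); case: (tnth _ _).
have [i1 d1] := diff _ _ ac; have [i2 d2] := diff _ _ ad.
have [i3 d3] := diff _ _ bc; have [i4 d4] := diff _ _ bd.
have f1 := flip i1; have f2 := flip i2; have f3 := flip i3; have f4 := flip i4.
rewrite ?(negPf d1) ?(negPf d2) ?(negPf d3) ?(negPf d4) ?andbF in f1 f2 f3 f4.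
have bits (s t u : bool) : s != t -> s != u -> t != u -> False.
  by case: s; case: t; case: u.
have ab i j := uniq1 a b i j ab1; have cd i j := uniq1 c d i j cd1.
(* If two witnesses with a common word were both the position where the other two words differ, then
   three words would be pairwise different at a single bit. *)
have no13 : tnth a i1 != tnth b i1 -> tnth a i3 != tnth b i3 -> False.
  by move=> s t; rewrite -(ab _ _ s t) in d3; exact: bits s d1 d3.
have no24 : tnth a i2 != tnth b i2 -> tnth a i4 != tnth b i4 -> False.
  by move=> s t; rewrite -(ab _ _ s t) in d4; exact: bits s d2 d4.
have no12 : tnth c i1 != tnth d i1 -> tnth c i2 != tnth d i2 -> False.
  by move=> s t; rewrite -(cd _ _ s t) in d2; exact: bits d1 d2 s.
have no34 : tnth c i3 != tnth d i3 -> tnth c i4 != tnth d i4 -> False.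
  by move=> s t; rewrite -(cd _ _ s t) in d4; exact: bits d3 d4 s.
(* The exclusions fix the kind of the witnesses in turn and force [i1 = i4]. There both pairs flip,
   so [i1] also coincides with a witness of the other kind, which is excluded. *)
case: (f1 isT) => g1.
- have {}f3 : tnth c i3 != tnth d i3 by case: (f3 isT) => // /(no13 g1).
  have {}f4 : tnth a i4 != tnth b i4 by case: (f4 isT) => // /(no34 f3).
  have e := ab _ _ g1 f4; rewrite -e in d4.
  case: (no13 g1); rewrite -(cd i1 i3) //.
  by move: d1 d4 g1; case: (tnth _ _); case: (tnth _ _); case: (tnth _ _); case: (tnth _ _).
- have {}f2 : tnth a i2 != tnth b i2 by case: (f2 isT) => // /(no12 g1).
  have {}f4 : tnth c i4 != tnth d i4 by case: (f4 isT) => // /(no24 f2).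
  have e := cd _ _ g1 f4; rewrite -e in d4.
  case: (no12 g1); rewrite -(ab i1 i2) //.
  by move: d1 d4 g1; case: (tnth _ _); case: (tnth _ _); case: (tnth _ _); case: (tnth _ _).
Qed.

Section GrayCover.
Context {n k : nat} (h : nat -> k.-tuple bool).
Hypotheses (n1 : 1 < n) (gray : gray_code (n - 1) h).
Hypotheses (k_le : k <= up_log 2 (n - 1)) (h0 : h 0 = h 1) (hn : h n = h (n - 1)).

(** The ordinal [i] stands for the index [i + 1], so [h i] and [h i.+1] are the code words of the at
    most two SOS2 sets containing that index, with repeated words at the ends. *)
Definition gray_biclique_SOS2 (j : 'I_k) : {set 'I_n} * {set 'I_n} :=
  ([set i : 'I_n | tnth (h i) j && tnth (h i.+1) j],
   [set i : 'I_n | ~~ tnth (h i) j && ~~ tnth (h i.+1) j]).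

(** Indices are first clamped to the range from 1 to [n - 1]. The bounds on [i'] and [i] exclude
    exactly the pairs (0, 1) and ([n - 1], [n]), and [2 < n] keeps the images of 0 and [n] apart. *)
Lemma gray_separated i i' :
  2 < n -> i < i' <= n -> 1 < i' -> i < n - 1 -> h i != h i'.
Proof.
move=> n2 /andP[ii' i'n] i'1 i_n; have [inj _] := gray.
have -> : h i = h (maxn 1 i) by case: (posnP i) => [->|?]; rewrite ?h0 //; congr h; lia.
have -> : h i' = h (minn i' (n - 1)).
  case: (leqP i' (n - 1)) => // ni'.
  by rewrite -hn; congr h; lia.
by apply/eqP => /inj; lia.
Qed.

Lemma gray_flip i : i < n -> #|[set j | tnth (h i) j != tnth (h i.+1) j]| <= 1.
Proof.
have stay s : #|[set j : 'I_k | tnth s j != tnth s j]| <= 1.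
  by rewrite eq_card0 // => j; rewrite !inE eqxx.
have [_ flip] := gray; case: i => [|i] lin; first by rewrite h0.
have [e|ne] := eqVneq i.+1 (n - 1); last by rewrite flip //; lia.
have -> : i.+2 = n by lia.
by rewrite hn e.
Qed.

Lemma gray_bit_plateau (j : 'I_k) (b : bool) :
  exists i : 'I_n, tnth (h i) j = b /\ tnth (h i.+1) j = b.
Proof.
have [/existsP[i /andP[/eqP ? /eqP ?]]|/existsPn none] := boolP [exists i : 'I_n,
  (tnth (h i) j == b) && (tnth (h i.+1) j == b)]; first by exists i.
have {}none i : i < n -> tnth (h i) j = b -> tnth (h i.+1) j <> b.
  by move=> lin; have := none (Ordinal lin); rewrite negb_and => /orP[]/eqP.
have [inj flip] := gray.
have flat i : 1 <= i <= n - 1 -> tnth (h i) j = ~~ b.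
  case: i => // i /andP[_ lin].
  case: (tnth (h i.+1) j =P b) => [hib|]; last by case: (tnth _ _); case: (b).
  have ne1 : tnth (h i) j <> b by move=> /none; apply=> //; lia.
  have ne2 : tnth (h i.+2) j <> b by apply: none => //; lia.
  (* At either end the repeated word would itself give two consecutive values [b], so this word has
     two genuine neighbours in the code. *)
  have i0 : 0 < i by case: i ne1 {lin ne2} hib => // + hib; rewrite h0 hib.
  have i2n : i.+2 <= n - 1.
    rewrite ltn_neqAle lin andbT; apply/eqP => e; apply: ne2.
    have -> : i.+2 = n by lia.
    by rewrite hn -e.
  suff /inj : h i = h i.+2 by lia.
  have bits1 : 1 <= i < n - 1 by lia.
  have bits2 : 1 <= i.+1 < n - 1 by lia.
  have /eqP/cards1P[j1 f1] := flip i bits1.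
  have /eqP/cards1P[j2 f2] := flip i.+1 bits2.
  have flip1 l : (tnth (h i) l != tnth (h i.+1) l) = (l == j1).
    by have /setP/(_ l) := f1; rewrite !inE.
  have flip2 l : (tnth (h i.+1) l != tnth (h i.+2) l) = (l == j2).
    by have /setP/(_ l) := f2; rewrite !inE.
  have jj1 : j = j1 by apply/eqP; rewrite -flip1 hib; apply/eqP.
  have jj2 : j = j2 by apply/eqP; rewrite -flip2 hib eq_sym; apply/eqP.
  apply/eq_from_tnth => l; have := flip1 l; have := flip2 l.
  rewrite -jj1 -jj2; have [->|_] := eqVneq l j.
    by move=> _ _; move: ne1 ne2; case: (tnth _ _); case: (tnth _ _); case: (b).
  by move=> /negbFE/eqP <- /negbFE/eqP ->.
(* Bit [j] is constant on the code, so it can be overwritten by a free bit without losing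
   injectivity. This fits twice [n - 1] words into [2 ^ k], whereas [k_le] gives
   [2 ^ k.-1 < n - 1]. *)
pose F (ic : 'I_(n - 1) * bool) : k.-tuple bool :=
  [tuple if l == j then ic.2 else tnth (h ic.1.+1) l | l < k].
have F_inj : injective F.
  move=> [i c] [i' c'] eF.
  have eFl l : tnth (F (i, c)) l = tnth (F (i', c')) l by rewrite eF.
  have := eFl j; rewrite !tnth_mktuple eqxx /= => <-; congr (_, _).
  have li := ltn_ord i; have li' := ltn_ord i'.
  apply/val_inj/succn_inj/inj => //.
  apply/eq_from_tnth => l; have := eFl l; rewrite !tnth_mktuple /=.
  by have [->|//] := eqVneq l j; rewrite !flat.
have := leq_card F F_inj.
rewrite card_prod card_ord card_bool card_tuple card_bool.
have k0 : 0 < k by case: k j {none flat F F_inj} => [[]|].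
have up1 : 1 < n - 1 by have := leq_trans k0 k_le; rewrite up_log_gt0.
have : 2 ^ k.-1 < n - 1.
  by apply: leq_ltn_trans (up_log_gtn (isT : 1 < 2) up1); rewrite ?leq_pexp2l //; lia.
by rewrite -{2}(prednK k0) expnS; lia.
Qed.

Lemma gray_cover_SOS2 : biclique_cover (conflict_edges (SOS2 n))
  [seq gray_biclique_SOS2 j | j : 'I_k].
Proof.
have plateau j : nontrivial (gray_biclique_SOS2 j).
  apply/andP; split; apply/set0Pn.
    by have [i [b0 b1]] := gray_bit_plateau j true; exists i; rewrite inE b0 b1.
  by have [i [b0 b1]] := gray_bit_plateau j false; exists i; rewrite inE b0 b1.
have disj j : (gray_biclique_SOS2 j).1 :&: (gray_biclique_SOS2 j).2 = set0.
  by apply/setP => i; rewrite !inE; case: (tnth (h i) j); rewrite /= ?andbF.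
split; last by move=> _ /imageP[j _ ->].
split=> [_ /imageP[j _ ->]|].
  (* Each side is proper because it misses a point of the other, nonempty side. *)
  have /andP[/set0Pn[x x1] /set0Pn[y y2]] := plateau j.
  have dis z : (z \in (gray_biclique_SOS2 j).1) && (z \in (gray_biclique_SOS2 j).2)
      = false by rewrite -in_setI disj inE.
  split=> //; apply/properP; split; rewrite ?subsetT //.
    by exists y; first rewrite inE //; have := dis y; rewrite y2 andbT => ->.
  by exists x; first rewrite inE //; have := dis x; rewrite x1 /= => ->.
have far (x y : 'I_n) : x.+1 < y -> exists2 p,
    p \in [seq gray_biclique_SOS2 j | j : 'I_k] & [set x; y] \in biclique_edges p.
  move=> xy; have ly := ltn_ord y.
  have [||||||j [hx hy hxy]] := @separating_bit _ (h x) (h x.+1) (h y) (h y.+1).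
  - exact: gray_flip.
  - exact: gray_flip.
  - by apply: gray_separated; lia.
  - by apply: gray_separated; lia.
  - by apply: gray_separated; lia.
  - by apply: gray_separated; lia.
  exists (gray_biclique_SOS2 j); first exact: image_f.
  apply/biclique_edgesP; case xj : (tnth (h x) j).
    by exists x, y; rewrite !inE -hx -hy xj; move: hxy; rewrite -hx xj; case: (tnth _ _).
  by exists y, x; rewrite !inE -hx -hy xj setUC; move: hxy; rewrite -hx xj; case: (tnth _ _).
apply: bigcup_biclique_edgesP => [_ x y /imageP[j _ ->]|x y].
  rewrite mem_conflict_edges_SOS2 ![_ \in finset _]inE => xj yj.
  have [//|nfar] := boolP (_ || _).
  (* Equal or adjacent indices share a code word, whose bit [j] would have to be both 1 and 0. *)
  have : [|| x == y :> nat, x.+1 == y | y.+1 == x] by lia.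
  by case/or3P => /eqP e; move: xj yj; rewrite /= ?e; do ![case: (tnth _ _)].
rewrite mem_conflict_edges_SOS2 => /orP[/far //|/far[p pc yx]].
by exists p; rewrite // setUC.
Qed.

End GrayCover.

(** * The two kinds of conflict edges of a grid triangulation *)

Section Conflicts.
Context {R : realType} {M N : nat} (SS : {set {set grid M N}}).
Hypothesis hSS : grid_triangulation R SS.
Implicit Types v w : grid M N.

(** Triangles have max-norm diameter at most 1, so none contains both points. *)
Lemma far_conflict v w : far v w -> [set v; w] \in conflict_edges SS.
Proof.
move=> vw; rewrite mem_conflict_edges; apply/andP; split.
  by apply: contraTneq vw => ->; rewrite /far !ltnNge !leqnSn.
apply/exists_inP => -[S SSS]; rewrite subUset !sub1set => /andP[vS wS].
have [_ _ _ diam] := hSS.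
have [] := grid_pt_norm_le1 _ _ (diam _ _ _ SSS vS wS).
by move: vw; rewrite /far !ltnNge => /or4P[]/negPf ->.
Qed.

Lemma conflict_far_or_diagonal v w :
  [set v; w] \in conflict_edges SS -> far v w || diagonal v w.
Proof.
rewrite mem_conflict_edges => /andP[vw inf_vw].
have far_axis : ~ (xcoord w = (xcoord v).+1 /\ ycoord w = ycoord v \/
    xcoord w = xcoord v /\ ycoord w = (ycoord v).+1).
  by move=> /(axis_edge_feasible _ _ _ hSS); rewrite inf_vw.
(* [axis_edge_feasible] is oriented, so it is applied to both orders of the pair. *)
have far_axis' : ~ (xcoord v = (xcoord w).+1 /\ ycoord v = ycoord w \/
    xcoord v = xcoord w /\ ycoord v = (ycoord w).+1).
  by move=> /(axis_edge_feasible _ _ _ hSS); rewrite setUC inf_vw.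
have : ~ (xcoord v = xcoord w /\ ycoord v = ycoord w).
  by case=> ex ey; move: vw; rewrite (grid_coord_inj _ _ ex ey) eqxx.
rewrite diagonalE /far; move: far_axis far_axis'; clear.
by move: (xcoord v) (ycoord v) (xcoord w) (ycoord w) => a b c d; lia.
Qed.

End Conflicts.

(** * The covers of the conflict graph and their depth *)

Theorem theorem4 (R : realType) (M N : nat) (SS : {set {set grid M N}})
    (hM : (0 < M)%N) (hN : (0 < N)%N) (hSS : grid_triangulation R SS) :
  (forall (c1 : seq ({set 'I_M} * {set 'I_M}))
          (c2 : seq ({set 'I_N} * {set 'I_N})),
     biclique_cover (conflict_edges (SOS2 M)) c1 ->
     biclique_cover (conflict_edges (SOS2 N)) c2 ->
     relaxed_biclique_cover (conflict_edges SS)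
       (map lift_x c1 ++ map lift_y c2 ++ diagonal_bicliques SS)
     /\ biclique_cover (conflict_edges SS)
       (map lift_x c1 ++ map lift_y c2
          ++ [seq p <- diagonal_bicliques SS | nontrivial p]))
  /\
  (forall (h1 : nat -> (up_log 2 (M - 1)).-tuple bool)
          (h2 : nat -> (up_log 2 (N - 1)).-tuple bool),
     gray_code (M - 1) h1 -> h1 0%N = h1 1%N -> h1 M = h1 (M - 1)%N ->
     gray_code (N - 1) h2 -> h2 0%N = h2 1%N -> h2 N = h2 (N - 1)%N ->
     [/\ relaxed_biclique_cover (conflict_edges SS)
           (gray_bicliques xcoord h1 ++ gray_bicliques ycoord h2
              ++ diagonal_bicliques SS),
         biclique_cover (conflict_edges SS)
           (gray_bicliques xcoord h1 ++ gray_bicliques ycoord h2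
              ++ [seq p <- diagonal_bicliques SS | nontrivial p])
       & size (gray_bicliques xcoord h1 ++ gray_bicliques ycoord h2
                 ++ diagonal_bicliques SS)
         = (up_log 2 (M - 1) + up_log 2 (N - 1) + 9)%N]).

Proof.
have [M1 N1] := grid_triangulation_gt1 _ hM hN hSS.
have cover c1 c2 : biclique_cover (conflict_edges (SOS2 M)) c1 ->
    biclique_cover (conflict_edges (SOS2 N)) c2 ->
    relaxed_biclique_cover (conflict_edges SS)
      (map lift_x c1 ++ map lift_y c2 ++ diagonal_bicliques SS)
    /\ biclique_cover (conflict_edges SS)
      (map lift_x c1 ++ map lift_y c2
         ++ [seq p <- diagonal_bicliques SS | nontrivial p]).
  move=> C1 C2; have rel := relaxed_cover_grid SS (far_conflict _ hSS)
    (conflict_far_or_diagonal _ hSS) _ _ M1 N1 C1 C2.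
  split=> //; have := relaxed_biclique_cover_nontrivial _ _ rel.
  rewrite !filter_cat.
  (* Lifting keeps both sides nonempty, so the filter acts on the diagonal pairs only. *)
  have /all_filterP -> : all nontrivial (map lift_x c1 : seq (_ * {set grid M N})).
    apply/allP => _ /mapP[p /(proj2 C1) p_nt ->].
    exact: nontrivial_lift_x.
  have /all_filterP -> // : all nontrivial (map lift_y c2 : seq (_ * {set grid M N})).
  apply/allP => _ /mapP[p /(proj2 C2) p_nt ->].
  exact: nontrivial_lift_y.
split=> // h1 h2 G1 h10 h1M G2 h20 h2N.
have C1 := gray_cover_SOS2 h1 M1 G1 (leqnn _) h10 h1M.
have C2 := gray_cover_SOS2 h2 N1 G2 (leqnn _) h20 h2N.
(* Since [xcoord z] is the successor of the ordinal [z.1], the words compared at [z] are those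
   compared at [z.1] in the SOS2 cover; hence the Gray pairs of the grid are lifts. *)
have <- : map (@lift_x M N) [seq gray_biclique_SOS2 h1 j | j : 'I__] =
    gray_bicliques xcoord h1.
  rewrite -map_comp; apply: eq_map => j.
  by congr (_, _); apply/setP => z; rewrite !inE !andbT.
have <- : map (@lift_y M N) [seq gray_biclique_SOS2 h2 j | j : 'I__] =
    gray_bicliques ycoord h2.
  rewrite -map_comp; apply: eq_map => j.
  by congr (_, _); apply/setP => z; rewrite !inE.
have [rel cov] := cover _ _ C1 C2; split=> //.
(* The summand 9 counts the residue pairs in ['I_3 * 'I_3]. *)
by rewrite !size_cat !size_map -!enumT -!cardT !card_ord card_prod !card_ord addnA.
Qed.
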